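(* Let $n\le 3$ and let $a_1,\ldots,a_n:\mathbb{Z}_+\to\mathbb{Z}$ be functions in $\mathrm{EQP}$, each eventually positive. Then the function $t\mapsto F\big(a_1(t),\ldots,a_n(t)\big)$ (defined for all sufficiently large $t$) is in $\mathrm{EQP}$.
   Context: For positive integers $a_1,\ldots,a_n$, let $\langle a_1,\ldots,a_n\rangle=\{\sum_{i=1}^n p_ia_i : p_i\in\mathbb{Z}_{\ge 0}\}$. The Frobenius number $F(a_1,\ldots,a_n)$ is the largest integer in the group $\mathbb{Z}a_1+\cdots+\mathbb{Z}a_n$ that is not in $\langle a_1,\ldots,a_n\rangle$; equivalently, if $d=\gcd(a_1,\ldots,a_n)$, then $F(a_1,\ldots,a_n)=d\,F(a_1/d,\ldots,a_n/d)$, where for relatively prime arguments $F$ is the largest integer not in the semigroup (so for $n=1$, $F(a_1)=-a_1$). A function $f:\mathbb{Z}_+\to\mathbb{Z}$ is a quasi-polynomial if there exist $m\in\mathbb{Z}_+$ and polynomials $f_0,\ldots,f_{m-1}\in\mathbb{Q}[t]$ with $f(t)=f_{t \bmod m}(t)$ for all $t\in\mathbb{Z}_+$. A property holds eventually if it holds for all sufficiently large $t$. $f\in\mathrm{EQP}$ means $f$ eventually agrees with a quasi-polynomial. *)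

(* Defs.v *)
From mathcomp Require Import all_boot all_order all_algebra.
Set Implicit Arguments.
Unset Strict Implicit.
Unset Printing Implicit Defensive.
Import GRing.Theory.
Local Open Scope ring_scope.

(* A function Z_+ -> Z is encoded as f : nat -> int; its value at 0 is junk and
   is never constrained below. *)

Definition eventually (P : nat -> Prop) : Prop :=
  exists T : nat, forall t : nat, (T <= t)%N -> P t.

(* The constituents are indexed by nat, but only p 0, ..., p (m - 1) matter. *)
Definition quasi_polynomial (f : nat -> int) : Prop :=
  exists m : nat, (0 < m)%N /\
  exists p : nat -> {poly rat},
    forall t : nat, (0 < t)%N -> (f t)%:~R = (p (t %% m)%N).[t%:R].

Definition EQP (f : nat -> int) : Prop :=
  exists g : nat -> int, quasi_polynomial g /\ eventually (fun t => f t = g t).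

Definition in_group (n : nat) (a : 'I_n -> int) (x : int) : Prop :=
  exists z : 'I_n -> int, x = \sum_(i < n) z i * a i.

Definition in_semigroup (n : nat) (a : 'I_n -> int) (x : int) : Prop :=
  exists p : 'I_n -> nat, x = \sum_(i < n) (p i)%:Z * a i.

(* x = F(a_1, ..., a_n). This is a relation because F is only partially
   defined; x is unique when it exists. The group need not be all of Z, and x
   may be negative: F(a_1) = - a_1. *)
Definition is_frobenius_number (n : nat) (a : 'I_n -> int) (x : int) : Prop :=
  [/\ in_group a x, ~ in_semigroup a x
    & forall y : int, in_group a y -> ~ in_semigroup a y -> y <= x].

(* Main.v *)
(* The Frobenius number of a, b, c is read off the lattice L of all (x, y) with
   b x + c y divisible by a. If L has a basis u = (p, - q), v = (- r, s) with
   0 <= r <= p, 0 <= q <= s on which l(x, y) = b x + c y is nonnegative, then the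
   points of the L-shape [0, p) x [0, s) minus [p - r, p) x [s - q, s) minimise l
   on the nonnegative points of their class modulo L, so that F + a is the larger of
   the values of l at the two outer corners of the L-shape. A basis of this kind is
   found by a Euclidean algorithm on the first coordinates.
   To run the algorithm on functions of t, one works near a point tau of the
   profinite integers: there every EQP function is a single polynomial, and the
   integer-valued polynomials form an ordered ring with division with remainder in
   which Euclid's algorithm terminates. Compactness of the profinite integers glues
   the resulting polynomials into a quasi-polynomial. *)
Require Import Defs.
From mathcomp Require Import all_boot all_order all_algebra.
From mathcomp Require Import boolp polyrcf.
From mathcomp Require Import zify ring lra.
Set Implicit Arguments.
Unset Strict Implicit.
Unset Printing Implicit Defensive.
Import Order.TTheory GRing.Theory Num.Theory.
Local Open Scope ring_scope.

(** * Lattice bases and the L-shape *)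

Definition lattice (a b c x y : int) : Prop := exists k : int, b * x + c * y = k * a.

(* The basis is (e, f), (- r, s). *)
Definition lattice_basis (a b c e f r s : int) : Prop :=
  [/\ lattice a b c e f, lattice a b c (- r) s, 0 < e * s + f * r &
      forall x y, lattice a b c x y -> exists i j, x = i * e - j * r /\ y = i * f + j * s].

(** The generators may coincide, so one or two generators are covered by repetition. *)
Definition frob3 (a b c x : int) : Prop :=
  [/\ exists u v w : int, x = u * a + v * b + w * c,
      ~ exists u v w : nat, x = u%:Z * a + v%:Z * b + w%:Z * c &
      forall y : int, (exists u v w : int, y = u * a + v * b + w * c) ->
        ~ (exists u v w : nat, y = u%:Z * a + v%:Z * b + w%:Z * c) -> y <= x].

Lemma lattice_basis_addl (a b c e f r s k : int) :
  lattice_basis a b c e f r s -> lattice_basis a b c (e - k * r) (f + k * s) r s.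
Proof.
case=> [[k1 h1] [k2 h2] hd gen]; split.
- by exists (k1 + k * k2); rewrite mulrDl -mulrA -h1 -h2; ring.
- by exists k2.
- by have -> : (e - k * r) * s + (f + k * s) * r = e * s + f * r by ring.
- move=> x y /gen[i [j [-> ->]]]; exists i, (j - i * k); split; ring.
Qed.

Lemma lattice_basis_addr (a b c e f r s k : int) :
  lattice_basis a b c e f r s -> lattice_basis a b c e f (r - k * e) (s + k * f).
Proof.
case=> [[k1 h1] [k2 h2] hd gen]; split.
- by exists k1.
- by exists (k2 + k * k1); rewrite mulrDl -mulrA -h1 -h2; ring.
- by have -> : e * (s + k * f) + f * (r - k * e) = e * s + f * r by ring.
- move=> x y /gen[i [j [-> ->]]]; exists (i - j * k), j; split; ring.
Qed.

Section LShape.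
Variables (p q r s : int).
Hypotheses (p_gt0 : 0 < p) (s_gt0 : 0 < s) (r_ge0 : 0 <= r) (q_ge0 : 0 <= q).
Hypotheses (le_rp : r <= p) (le_qs : q <= s).

(** The point moved is an outer corner. If only one of [i], [j] is negative, one coordinate is
    clearly negative; if both are, [r <= p] in the first inequality forces [j <= i] and [q <= s] in
    the second forces [i < j]. *)
Lemma corner_shift (i j : int) :
  0 <= (p - 1) + i * p - j * r -> 0 <= (s - q - 1) - i * q + j * s -> 0 <= i /\ 0 <= j.
Proof.
move=> hX hY; case: (leP 0 i) => hi; case: (leP 0 j) => hj; first (by []); exfalso.
- nia.
- have hi1 : 0 <= - (i + 1) by lia.
  nia.
- have hi1 : 0 <= - (i + 1) by lia.
  have hj1 : 0 <= - (j + 1) by lia.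
  have h1 : (- (i + 1)) * p <= (- j) * r - 1 by lia.
  have h2 : (- (j + 1)) * s <= (- (i + 1)) * q - 1 by lia.
  case: (leP (- j) (- (i + 1))) => hh; nia.
Qed.

(** The form [(s + q) x + (p + r) y] takes the value [p s - q r] on both basis vectors. From a
    nonnegative point outside the L-shape one can subtract [(p, - q)], [(- r, s)] or their sum and
    stay nonnegative, which lowers the form. *)
Lemma lshape_reduce (x y : int) : 0 < p * s - q * r -> 0 <= x -> 0 <= y ->
  exists i j : int, let x' := x + i * p - j * r in let y' := y - i * q + j * s in
    [/\ 0 <= x' < p, 0 <= y' < s & (x' < p - r) || (y' < s - q)].
Proof.
move=> hdet.
have [n] := ubnP (absz ((s + q) * x + (p + r) * y)).
elim: n x y => // n IH x y hn hx hy.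
have hm : 0 <= (s + q) * x + (p + r) * y by nia.
have descend i0 j0 : 0 <= x + i0 * p - j0 * r -> 0 <= y - i0 * q + j0 * s -> i0 + j0 < 0 ->
  exists i j : int, let x' := x + i * p - j * r in let y' := y - i * q + j * s in
    [/\ 0 <= x' < p, 0 <= y' < s & (x' < p - r) || (y' < s - q)].
  move=> h1 h2 h3.
  have hf : (s + q) * (x + i0 * p - j0 * r) + (p + r) * (y - i0 * q + j0 * s)
     = (s + q) * x + (p + r) * y + (i0 + j0) * (p * s - q * r) by ring.
  have hl : (s + q) * (x + i0 * p - j0 * r) + (p + r) * (y - i0 * q + j0 * s)
     < (s + q) * x + (p + r) * y by rewrite hf; nia.
  have hp : 0 <= (s + q) * (x + i0 * p - j0 * r) + (p + r) * (y - i0 * q + j0 * s) by nia.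
  have [|//|//|i [j [h4 h5 h6]]] := IH (x + i0 * p - j0 * r) (y - i0 * q + j0 * s).
    by lia.
  exists (i + i0), (j + j0).
  have -> : x + (i + i0) * p - (j + j0) * r = x + i0 * p - j0 * r + i * p - j * r by ring.
  have -> : y - (i + i0) * q + (j + j0) * s = y - i0 * q + j0 * s - i * q + j * s by ring.
  by [].
case: (ltP x p) => h1; last by apply: (descend (-1) 0); lia.
case: (ltP y s) => h2; last by apply: (descend 0 (-1)); lia.
case hh : ((x < p - r) || (y < s - q)); last by apply: (descend (-1) (-1)); lia.
by exists 0, 0; rewrite !mul0r oppr0 !addr0 /= hx hy h1 h2.
Qed.

End LShape.

Lemma frob3_basis (a b c p q r s F : int) :
  0 < a -> 0 < b -> 0 < c -> 0 < p -> 0 < s -> 0 <= r <= p -> 0 <= q <= s ->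
  0 <= b * p - c * q -> 0 <= c * s - b * r ->
  lattice_basis a b c p (- q) r s ->
  F = Num.max (b * (p - 1) + c * (s - q - 1)) (b * (p - r - 1) + c * (s - 1)) - a ->
  frob3 a b c F.
Proof.
move=> a0 b0 c0 p0 s0 /andP[r0 rp] /andP[q0 qs] lu lv [Lu Lv hdet gen] FE.
(* A representation makes [(v, w)] congruent to [(x, y)] with a value smaller by [(u + 1) a],
   although nonnegative [i], [j] can only raise the value. *)
have small (x y : int) :
  (forall i j, 0 <= x + i * p - j * r -> 0 <= y - i * q + j * s -> 0 <= i /\ 0 <= j) ->
  ~ exists u v w : nat, b * x + c * y - a = u%:Z * a + v%:Z * b + w%:Z * c.
  move=> hxy [u [v [w h]]].
  have [i [j [hi hj]]] : exists i j, v%:Z - x = i * p - j * r /\ w%:Z - y = i * (- q) + j * s.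
    by apply: gen; exists (- (u%:Z + 1)); rewrite mulNr mulrDl mul1r; lia.
  have [i0 j0] : 0 <= i /\ 0 <= j by apply: hxy; lia.
  have hl : b * (v%:Z - x) + c * (w%:Z - y) = - ((u%:Z + 1) * a) by lia.
  have : b * (v%:Z - x) + c * (w%:Z - y) = i * (b * p - c * q) + j * (c * s - b * r).
    by rewrite hi hj; ring.
  have : 0 <= u%:Z * a by nia.
  have : 0 <= i * (b * p - c * q) by nia.
  have : 0 <= j * (c * s - b * r) by nia.
  lia.
split.
- rewrite FE; case: (leP (b * (p - 1) + c * (s - q - 1)) (b * (p - r - 1) + c * (s - 1))) => _.
    by exists (-1), (p - r - 1), (s - 1); ring.
  by exists (-1), (p - 1), (s - q - 1); ring.
- rewrite FE; case: (leP (b * (p - 1) + c * (s - q - 1)) (b * (p - r - 1) + c * (s - 1))) => _.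
    apply: small => i j hx hy.
    suff [] : 0 <= j /\ 0 <= i by [].
    (* The second corner is the first one with the coordinates exchanged. *)
    by apply: (@corner_shift s r q p) => //; lia.
  by apply: small => i j; apply: corner_shift.
- move=> y [u [v [w yE]]] ynot.
  (* Multiples of [a] added to [v] and [w] are compensated in the coefficient of [a]. *)
  have [k [k0 hk1 hk2]] : exists k : int, [/\ 0 <= k, 0 <= v + k * a & 0 <= w + k * a].
    have hN : 0 <= (`|v| + `|w|) * (a - 1) by apply: mulr_ge0; lia.
    by exists (`|v| + `|w|); split; lia.
  have [|i [j [hx hy hxy]]] := lshape_reduce p0 s0 r0 q0 rp qs _ hk1 hk2; first by lia.
  set x' := v + k * a + i * p - j * r in hx hxy.
  set y' := w + k * a - i * q + j * s in hy hxy.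
  have [z zE] : exists z, y = b * x' + c * y' + z * a.
    case: Lu => ku hu; case: Lv => kv hv.
    exists (u - b * k - c * k - i * ku - j * kv).
    have -> : (u - b * k - c * k - i * ku - j * kv) * a =
      u * a - b * k * a - c * k * a - i * (ku * a) - j * (kv * a) by ring.
    rewrite -hu -hv yE /x' /y'; ring.
  have z0 : z <= - 1.
    case: (leP z (-1)) => // hz; exfalso; apply: ynot.
    exists `|z|%N, `|x'|%N, `|y'|%N; rewrite !gez0_abs; [rewrite zE; ring|lia|lia|lia].
  rewrite FE zE.
  suff : b * x' + c * y' <= Num.max (b * (p - 1) + c * (s - q - 1)) (b * (p - r - 1) + c * (s - 1)).
    have : z * a <= - a by nia.
    by set M := Num.max _ _; lia.
  rewrite le_max; case/orP: hxy => h; apply/orP; [right|left]; nia.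
Qed.

(** * Values of integer and rational polynomials *)

Lemma dvdz_horner_sub (p : {poly int}) (x y : int) : (x - y %| p.[x] - p.[y])%Z.
Proof.
have /factor_theorem[q hq] : root (p - p.[y]%:P) y.
  by rewrite /root !hornerE subrr.
apply/dvdzP; exists q.[x].
by have := congr1 (horner^~ x) hq; rewrite !hornerE.
Qed.

Lemma rat_poly_scale_nat (p : {poly rat}) :
  exists (q : {poly int}) (d : nat), (0 < d)%N /\ p = d%:R^-1 *: map_poly intr q.
Proof.
have [q [a a_neq0 ->]] := rat_poly_scale p.
exists (sgz a *: q), `|a|%N; split; first by rewrite absz_gt0.
rewrite map_polyZ /= scalerA; congr (_ *: _).
rewrite natr_absz.
case: (ltgtP a 0) a_neq0 => // ha _.
- by rewrite ltr0_norm // ltr0_sgz // mulrNz invrN mulrN1 opprK.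
- by rewrite gtr0_norm // gtr0_sgz // mulr1.
Qed.

Lemma lead_coef_gt0_ultimately (p : {poly rat}) : 0 < lead_coef p ->
  exists T : nat, forall t : nat, (T <= t)%N -> 0 < p.[t%:R].
Proof.
move=> hp; have [x hx] := poly_pinfty_gt_lc hp.
exists (Num.bound `|x|) => t ht; apply: lt_le_trans hp (hx _ _).
apply: le_trans (ler_norm x) _; apply/ltW/(lt_le_trans (archi_boundP (normr_ge0 x))).
by rewrite ler_nat.
Qed.

(** * Germs of polynomials at a profinite integer *)

(* A coherent tau is a profinite integer, tau m being its residue modulo m;
   [along tau] quantifies over the large t close to it. *)
Definition coherent (tau : nat -> nat) : Prop :=
  forall m k : nat, (0 < m)%N -> (0 < k)%N -> tau (m * k)%N = tau m %[mod m].

Section Along.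
Variable tau : nat -> nat.
Hypothesis tau_coh : coherent tau.

Definition along (P : nat -> Prop) : Prop :=
  exists m T : nat, (0 < m)%N /\ forall t, (T <= t)%N -> t = tau m %[mod m] -> P t.

Lemma alongT (P : nat -> Prop) : (forall t, P t) -> along P.
Proof. by move=> h; exists 1%N, 0%N; split. Qed.

Lemma along_ge (T : nat) : along (fun t => (T <= t)%N).
Proof. by exists 1%N, T. Qed.

(** By coherence the class of [tau (m * m')] modulo [m * m'] lies in both given classes. *)
Lemma alongI (P Q : nat -> Prop) : along P -> along Q -> along (fun t => P t /\ Q t).
Proof.
case=> [m [T [m0 h]]] [m' [T' [m0' h']]].
exists (m * m')%N, (maxn T T'); split; first by rewrite muln_gt0 m0.
move=> t; rewrite geq_max => /andP[hT hT'] ht.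
have redl k d : (k * d)%N = (m * m')%N -> (0 < k)%N -> (0 < d)%N -> t = tau k %[mod k].
  move=> kd k0 d0; rewrite -(tau_coh k0 d0) kd.
  by rewrite -(modn_dvdm t (dvdn_mulr d (dvdnn k))) kd ht -kd modn_dvdm // dvdn_mulr.
split; first by apply: h hT (redl _ m' _ _ _).
by apply: h' hT' (redl _ m _ _ _) => //; rewrite mulnC.
Qed.

Lemma along1 (P R : nat -> Prop) : along P -> (forall t, P t -> R t) -> along R.
Proof. by case=> [m [T [m0 h]]] hPR; exists m, T; split => // t ht hm; apply/hPR/h. Qed.

Lemma along2 (P Q R : nat -> Prop) :
  along P -> along Q -> (forall t, P t -> Q t -> R t) -> along R.
Proof. by move=> hP hQ h; apply: along1 (alongI hP hQ) _ => t [? ?]; apply: h. Qed.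

Lemma along3 (P Q S R : nat -> Prop) :
  along P -> along Q -> along S -> (forall t, P t -> Q t -> S t -> R t) -> along R.
Proof. by move=> hP hQ hS h; apply: along2 (alongI hP hQ) hS _ => t [? ?]; apply: h. Qed.

Lemma along_ex (P : nat -> Prop) : along P -> exists t, P t.
Proof.
case=> [m [T [m0 h]]]; exists (tau m + T * m)%N; apply: h.
  by apply: leq_trans (leq_addl _ _); rewrite leq_pmulr.
by rewrite addnC modnMDl.
Qed.

Definition poly_along (p : {poly rat}) (f : nat -> int) : Prop :=
  along (fun t => (f t)%:~R = p.[t%:R]).

Definition pol (f : nat -> int) : Prop := exists p, poly_along p f.

Lemma polC (c : int) : pol (fun=> c).
Proof. by exists (c%:~R%:P); apply: alongT => t; rewrite hornerC. Qed.

Lemma polD f g : pol f -> pol g -> pol (fun t => f t + g t).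
Proof.
move=> [p hp] [q hq]; exists (p + q); apply: along2 hp hq _ => t ft gt.
by rewrite rmorphD /= ft gt hornerD.
Qed.

Lemma polM f g : pol f -> pol g -> pol (fun t => f t * g t).
Proof.
move=> [p hp] [q hq]; exists (p * q); apply: along2 hp hq _ => t ft gt.
by rewrite rmorphM /= ft gt hornerM.
Qed.

Lemma polN f : pol f -> pol (fun t => - f t).
Proof.
move=> [p hp]; exists (- p); apply: along1 hp _ => t ft.
by rewrite rmorphN /= ft hornerN.
Qed.

Lemma polB f g : pol f -> pol g -> pol (fun t => f t - g t).
Proof. by move=> hf hg; apply: polD => //; apply: polN. Qed.

Lemma pol_eq f g : pol f -> along (fun t => f t = g t) -> pol g.
Proof. by move=> [p hp] hfg; exists p; apply: along2 hp hfg _ => t <- ->. Qed.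

Lemma lead_coef_gt0_along (p : {poly rat}) :
  0 < lead_coef p -> along (fun t => 0 < p.[t%:R]).
Proof.
by move=> /lead_coef_gt0_ultimately[T hT]; apply: along1 (along_ge T) _ => t; apply: hT.
Qed.

Lemma poly_trichotomy (p : {poly rat}) :
  [\/ along (fun t => p.[t%:R] < 0), p = 0 | along (fun t => 0 < p.[t%:R])].
Proof.
have [->|p0] := eqVneq p 0; first by constructor 2.
case: (ltgtP (lead_coef p) 0) => h.
- constructor 1; rewrite -oppr_gt0 -lead_coefN in h.
  by apply: along1 (lead_coef_gt0_along h) _ => t; rewrite hornerN oppr_gt0.
- by constructor 3; apply: lead_coef_gt0_along.
- by move/eqP: h; rewrite lead_coef_eq0 (negPf p0).
Qed.

Lemma pol_trichotomy f : pol f ->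
  [\/ along (fun t => f t < 0), along (fun t => f t = 0) | along (fun t => 0 < f t)].
Proof.
move=> [p hp]; case: (poly_trichotomy p) => h.
- by constructor 1; apply: along2 h hp _ => t hl ht; rewrite -ht ltrz0 in hl.
- constructor 2; apply: along1 hp _ => t /eqP.
  by rewrite h horner0 intr_eq0 => /eqP.
- by constructor 3; apply: along2 h hp _ => t hl ht; rewrite -ht ltr0z in hl.
Qed.

Lemma pol_le_lt f g : pol f -> pol g ->
  along (fun t => f t <= g t) \/ along (fun t => g t < f t).
Proof.
move=> hf hg; case: (pol_trichotomy (polB hf hg)) => h.
- by left; apply: along1 h _ => t; lia.
- by left; apply: along1 h _ => t; lia.
- by right; apply: along1 h _ => t; lia.
Qed.

(** If the degree is [n] this is the leading coefficient, otherwise it is 0. It serves for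
    polynomials whose degree is only bounded. *)
Lemma coef_along_ge0 (p : {poly rat}) (n : nat) :
  (size p <= n.+1)%N -> along (fun t => 0 <= p.[t%:R]) -> 0 <= p`_n.
Proof.
move=> hs hp; rewrite leNgt; apply/negP => hn.
have sz : size p = n.+1.
  apply/eqP; rewrite eqn_leq hs ltnNge; apply/negP => h.
  by rewrite nth_default ?ltxx in hn.
have : 0 < lead_coef (- p) by rewrite lead_coefN oppr_gt0 /lead_coef sz.
move=> /lead_coef_gt0_along hq.
have [t [h1 h2]] := along_ex (alongI hp hq).
by move: h2; rewrite hornerN oppr_gt0 ltNge h1.
Qed.

(** Were the degree [n] of [p] larger, the coefficients of [t^n] in [p] and [q - p] would be
    opposite and both nonnegative, so the leading one would vanish. *)
Lemma size_squeeze (p q : {poly rat}) :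
  along (fun t => 0 <= p.[t%:R] <= q.[t%:R]) -> (size p <= size q)%N.
Proof.
move=> h; rewrite leqNgt; apply/negP => hs.
have p0 : (0 < size p)%N by apply: leq_ltn_trans hs.
have [n hn] : exists n, size p = n.+1 by exists (size p).-1; rewrite prednK.
have h1 : 0 <= p`_n.
  by apply: coef_along_ge0; [rewrite hn|apply: along1 h _ => t /andP[]].
have h2 : 0 <= (q - p)`_n.
  apply: coef_along_ge0.
    rewrite (leq_trans (size_polyD _ _)) // size_polyN geq_max hn leqnn andbT.
    by rewrite -hn ltnW.
  by apply: along1 h _ => t /andP[_]; rewrite hornerD hornerN subr_ge0.
have qn : q`_n = 0 by rewrite nth_default // -ltnS -hn.
rewrite coefB qn sub0r oppr_ge0 in h2.
have : lead_coef p == 0 by rewrite /lead_coef hn /= eq_le h1 h2.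
by rewrite lead_coef_eq0 -size_poly_eq0 hn.
Qed.

(** * Division with remainder, Euclid's algorithm and Bezout identities for germs *)

(** Write the rational quotient as [q / d]. Close to [tau] the residue [c] of [q] modulo [d] is
    constant, so rounding down subtracts the constant [x = c / d]. The new remainder [S] lies
    strictly between [- pb] and [pb], and its sign decides between [k] and [k - 1]. *)
Lemma pol_div a b : pol a -> pol b -> along (fun t => 0 < b t) ->
  pol (fun t => (a t %/ b t)%Z).
Proof.
move=> [pa ha] [pb hb] b_gt0.
have lb : 0 < lead_coef pb.
  case: (poly_trichotomy pb) => h.
  - have [t [[h1 h2] h3]] := along_ex (alongI (alongI hb b_gt0) h).
    by move: h3; rewrite -h1 ltrz0; lia.
  - have [t [h1 h2]] := along_ex (alongI hb b_gt0).
    by move/eqP: h1; rewrite h horner0 intr_eq0; lia.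
  - rewrite ltNge; apply/negP => hl.
    rewrite -oppr_ge0 -lead_coefN le_eqVlt eq_sym lead_coef_eq0 oppr_eq0 in hl.
    case/orP: hl => [/eqP p0 | /lead_coef_gt0_along hl].
      by have [t] := along_ex h; rewrite p0 horner0 ltxx.
    have [t [h1 h2]] := along_ex (alongI h hl).
    by move: h2; rewrite hornerN oppr_gt0 ltNge ltW.
have pb0 : pb != 0 by rewrite -lead_coef_eq0 gt_eqF.
have [q [d [d_gt0 Qq]]] := rat_poly_scale_nat (pa %/ pb).
set R := pa %% pb.
have szR : (size R < size pb)%N by rewrite ltn_modp.
have dQ0 : (d%:R : rat) != 0 by rewrite pnatr_eq0 -lt0n.
pose c := (q.[(tau d)%:Z] %% d)%Z.
have c0 : 0 <= c by apply: modz_ge0; lia.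
have cd : c < d by apply: (@ltz_pmod q.[(tau d)%:Z] d); lia.
pose x : rat := c%:~R / d%:R.
have x0 : 0 <= x by rewrite divr_ge0 ?ler0z.
have x1 : x < 1 by rewrite ltr_pdivrMr ?ltr0n // mul1r -[d%:R]/(d%:~R) ltr_int.
pose k t := (q.[t%:Z] %/ d)%Z.
pose Q' := pa %/ pb - x%:P.
pose S := x *: pb + R.
have hk : poly_along Q' k.
  exists d, 0%N; split=> // t _ ht.
  have hc : (q.[t%:Z] %% d)%Z = c.
    rewrite /c; apply/eqP; rewrite eqz_mod_dvd.
    apply: dvdz_trans (dvdz_horner_sub _ _ _).
    by rewrite -eqz_mod_dvd; apply/eqP; rewrite -!/(modz _ _) !modz_nat ht.
  have := divz_eq q.[t%:Z] d; rewrite hc -/(k t) => hq.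
  rewrite /Q' Qq !hornerE -[t%:R]/(t%:~R) horner_map /= hq rmorphD rmorphM /= /x.
  by rewrite mulrDr mulrCA mulVf // mulr1 [d%:R^-1 * _]mulrC addrK.
have hS : along (fun t => ((a t - k t * b t)%:~R = S.[t%:R])).
  apply: along3 ha hb hk _ => t hat hbt hkt.
  rewrite rmorphB rmorphM /= hat hbt hkt {1}(divp_eq pa pb) -/R /Q' /S.
  by rewrite !hornerE; ring.
have hSb : along (fun t => S.[t%:R] < pb.[t%:R]).
  have : 0 < lead_coef (pb - S).
    have -> : pb - S = (1 - x) *: pb - R by rewrite /S scalerBl scale1r opprD addrA.
    have h1x : 1 - x != 0 by rewrite subr_eq0 gt_eqF.
    rewrite lead_coefDl; last by rewrite size_polyN size_scale.
    by rewrite lead_coefZ mulr_gt0 ?subr_gt0.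
  by move=> /lead_coef_gt0_along h; apply: along1 h _ => t; rewrite hornerD hornerN subr_gt0.
have hSN : along (fun t => - pb.[t%:R] < S.[t%:R]).
  have : 0 < lead_coef (pb + S).
    have -> : pb + S = (1 + x) *: pb + R by rewrite /S scalerDl scale1r addrA.
    have h1x : 1 + x != 0 by rewrite gt_eqF // ltr_wpDr.
    rewrite lead_coefDl; last by rewrite size_scale.
    by rewrite lead_coefZ mulr_gt0 // ltr_wpDr.
  move=> /lead_coef_gt0_along h; apply: along1 h _ => t.
  by rewrite hornerD => hpos; lra.
have divE (u v w : int) : 0 <= u - w * v < v -> (u %/ v)%Z = w.
  move=> /andP[h1 h2]; have -> : u = w * v + (u - w * v) by ring.
  rewrite divzMDl; last by lia.
  by rewrite divz_small ?addr0 //; apply/andP; split; lia.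
have hb1 : along (fun t => a t - k t * b t < b t).
  by apply: along3 hS hSb hb _ => t h1 h2 h3; rewrite -h1 -h3 ltr_int in h2.
have hb2 : along (fun t => - b t < a t - k t * b t).
  by apply: along3 hS hSN hb _ => t h1 h2 h3; rewrite -h1 -h3 -rmorphN ltr_int in h2.
have polk : pol k by exists Q'.
have pola : pol a by exists pa.
have polb : pol b by exists pb.
case: (pol_le_lt (polC 0) (polB pola (polM polk polb))) => h.
- apply: (pol_eq polk); apply: along2 h hb1 _ => t h1 h2.
  by rewrite (divE _ _ (k t)) // h1 h2.
- apply: (pol_eq (polB polk (polC 1))); apply: along2 h hb2 _ => t h1 h2.
  by rewrite (divE _ _ (k t - 1)) //; lia.
Qed.


Lemma pol_mod a b : pol a -> pol b -> along (fun t => 0 < b t) ->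
  pol (fun t => (a t %% b t)%Z).
Proof. by move=> ha hb b0; apply: (polB ha); apply: polM => //; apply: pol_div. Qed.

Lemma common_denominator (x y : rat) : 0 <= x -> 0 <= y ->
  exists D A B : nat, [/\ (0 < D)%N, x * D%:R = A%:R & y * D%:R = B%:R].
Proof.
move=> x0 y0.
have num_den (z : rat) : 0 <= z -> z * `|denq z|%N%:R = `|numq z|%N%:R.
  move=> z0; rewrite !natr_absz !ger0_norm ?numq_ge0 ?denq_ge0 //.
  by rewrite -{1}(divq_num_den z) mulrVK // unitfE intr_eq0 denq_neq0.
exists (`|denq x| * `|denq y|)%N, (`|numq x| * `|denq y|)%N, (`|numq y| * `|denq x|)%N.
split; first by rewrite muln_gt0 !absz_gt0 !denq_neq0.
  by rewrite !natrM mulrA num_den.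
by rewrite !natrM [X in y * X]mulrC mulrA num_den.
Qed.

(** The remainder can have the same degree as the divisor, because rounding the rational quotient
    puts a multiple of [pb] back into it. *)
Lemma poly_along_mod a b pa pb : poly_along pa a -> poly_along pb b ->
  along (fun t => 0 < b t) ->
  exists pq pr, [/\ poly_along pq (fun t => (a t %/ b t)%Z),
    poly_along pr (fun t => (a t %% b t)%Z), pr = pa - pq * pb & (size pr <= size pb)%N].
Proof.
move=> ha hb b0.
have [pq hq] : pol (fun t => (a t %/ b t)%Z) by apply: pol_div => //; [exists pa|exists pb].
have hr : poly_along (pa - pq * pb) (fun t => (a t %% b t)%Z).
  apply: along3 ha hb hq _ => t hat hbt hqt.
  by rewrite /modz rmorphB rmorphM /= hat hbt hqt !hornerE.
exists pq, (pa - pq * pb); split => //.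
apply: size_squeeze; apply: along3 hr hb b0 _ => t <- <- bt0.
by rewrite ler0z ler_int modz_ge0 ?gt_eqF //= ltW // ltz_pmod.
Qed.

Lemma along_False (P : nat -> Prop) : along P -> (forall t, ~ P t) -> False.
Proof. by move=> /along_ex[t h] /(_ t); apply. Qed.

(* The germs along tau of integer-valued polynomials form a ring in which the
   Euclidean algorithm terminates: while the degree n of the divisor does not
   drop, the quotients are constant, so the coefficients of t^n keep a common
   denominator D and the sum of the two leading ones decreases by at least 1/D. *)
Lemma euclid_ind (P : (nat -> int) -> (nat -> int) -> Prop) :
  (forall a b, pol a -> pol b -> along (fun t => 0 < a t) -> along (fun t => b t = 0) ->
    P a b) ->
  (forall a b, pol a -> pol b -> along (fun t => 0 < b t < a t) ->
    P b (fun t => (a t %% b t)%Z) -> P a b) ->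
  forall a b, pol a -> pol b -> along (fun t => 0 <= b t < a t) -> P a b.
Proof.
move=> H0 HS.
have step a b : pol a -> pol b -> along (fun t => 0 <= b t < a t) ->
    (along (fun t => 0 < b t) -> P b (fun t => (a t %% b t)%Z)) -> P a b.
  move=> ha hb hab hP; case: (pol_trichotomy hb) => h.
  - by case: (along_False (alongI h hab)) => t; lia.
  - by apply: H0 => //; apply: along1 hab _ => t; lia.
  - by apply: HS (hP h) => //; apply: along2 h hab _ => t; lia.
have modlt a b : along (fun t => 0 < b t) -> along (fun t => 0 <= (a t %% b t)%Z < b t).
  by move=> h; apply: along1 h _ => t bt; rewrite modz_ge0 ?gt_eqF //= ltz_pmod.
suff main n : forall a b pb, pol a -> poly_along pb b -> along (fun t => 0 <= b t < a t) ->
    (size pb <= n)%N -> P a b.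
  by move=> a b ha [pb hb] hab; apply: (main (size pb) a b pb).
elim: n => [|n IH] a b pb ha hb hab sz.
  apply: H0 => //; first by exists pb.
    by apply: along1 hab _ => t; lia.
  move: sz; rewrite leqn0 size_poly_eq0 => /eqP pb0.
  by apply: along1 hb _ => t; rewrite pb0 horner0 => /eqP; rewrite intr_eq0 => /eqP.
(* [A / D] and [B / D] are the coefficients of [t^n]; the inner induction is on [A + B]. *)
have inner k : forall a b pa pb (D A B : nat), (0 < D)%N -> poly_along pa a ->
    poly_along pb b -> along (fun t => 0 <= b t < a t) -> (size pa <= n.+1)%N ->
    (size pb <= n.+1)%N -> pa`_n * D%:R = A%:R -> pb`_n * D%:R = B%:R ->
    (A + B < k)%N -> P a b.
  clear a b pb ha hb hab sz; elim: k => // k IHk a b pa pb D A B D0 ha hb hab sza szb hA hB hk.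
  have [h|h] := leqP (size pb) n; first by apply: (IH a b pb) => //; exists pa.
  have {h}szb : size pb = n.+1 by apply/eqP; rewrite eqn_leq szb h.
  apply: step => //; [by exists pa|by exists pb|move=> b0].
  have [pq [pr [hq hr prE szr]]] := poly_along_mod ha hb b0.
  have pb0 : pb != 0 by rewrite -size_poly_eq0 szb.
  have szq : (size pq <= 1)%N.
    have [->|pq0] := eqVneq pq 0; first by rewrite size_poly0.
    have : (size (pq * pb)%R <= n.+1)%N.
      have -> : pq * pb = pa - pr by rewrite prE; ring.
      by rewrite (leq_trans (size_polyD _ _)) // size_polyN geq_max sza -szb.
    rewrite size_mul // szb addnS /= => h.
    by rewrite -(leq_add2r n) add1n.
  (* [b < a] gives [z >= 1]; the numerators become [B] and [A - z B], with sum at most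
     [A < A + B]. *)
  have [z z1 zE] : exists2 z : int, 1 <= z & pq = (z%:~R)%:P.
    have [t [h1 h2]] := along_ex (alongI hq (alongI b0 hab)).
    exists (a t %/ b t)%Z; first by rewrite lez_divRL; lia.
    by rewrite h1 (size1_polyC szq) hornerC.
  have prn : pr`_n = pa`_n - z%:~R * pb`_n by rewrite prE zE coefB coefCM.
  have prn0 : 0 <= pr`_n.
    apply: coef_along_ge0; first by rewrite (leq_trans szr) ?szb.
    apply: along2 hr (modlt a b b0) _ => t <-; rewrite ler0z; lia.
  have pbn0 : 0 < pb`_n.
    rewrite lt_neqAle; apply/andP; split.
      by rewrite eq_sym -[n]/(n.+1.-1) -szb -/(lead_coef pb) lead_coef_eq0.
    apply: coef_along_ge0; first by rewrite szb.
    by apply: along2 hb b0 _ => t <-; rewrite ler0z; lia.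
  have B0 : (0 < B)%N by rewrite -(ltr0n rat) -hB mulr_gt0 // ltr0n.
  have prD : pr`_n * D%:R = (A%:Z - z * B%:Z)%:~R.
    by rewrite prn mulrBl hA -mulrA hB rmorphB rmorphM.
  have R0 : 0 <= A%:Z - z * B%:Z.
    by rewrite -(ler0z rat) -prD mulr_ge0 // ler0n.
  apply: (IHk _ _ pb pr D B `|(A%:Z - z * B%:Z)%R|%N) => //; try exact: modlt.
  - by rewrite szb.
  - by rewrite (leq_trans szr) ?szb.
  - by rewrite prD natr_absz ger0_norm.
  - by nia.
have [h|h] := leqP (size pb) n; first exact: (IH a b pb).
(* The degree of [a] is not bounded by [n]; one division yields a pair in which both degrees are. *)
apply: step => //; [by exists pb|move=> b0].
have [pa hpa] := ha.
have [pq [pr [hq hr _ szr]]] := poly_along_mod hpa hb b0.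
have [||D [A [B [D0 hA hB]]]] := @common_denominator pb`_n pr`_n.
- by apply: coef_along_ge0 => //; apply: along2 hb b0 _ => t <-; rewrite ler0z; lia.
- apply: coef_along_ge0; first exact: leq_trans szr sz.
  by apply: along2 hr (modlt a b b0) _ => t <-; rewrite ler0z; lia.
by apply: (inner (A + B).+1 _ _ pb pr D A B) => //; [apply: modlt|apply: leq_trans szr sz].
Qed.

(** The cofactors [a'], [b'] are built up together with the Bezout coefficients, which keeps the
    identity in the form already divided by [g]. *)
Lemma pol_bezout a b : pol a -> pol b -> along (fun t => 0 < a t) ->
  exists g x y a' b', [/\ pol g, pol x, pol y, pol a' & pol b'] /\
    along (fun t => [/\ 0 < g t, a t = a' t * g t, b t = b' t * g t &
                        a' t * x t + b' t * y t = 1]).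
Proof.
move=> ha hb a0.
pose P a b := exists g x y a' b', [/\ pol g, pol x, pol y, pol a' & pol b'] /\
    along (fun t => [/\ 0 < g t, a t = a' t * g t, b t = b' t * g t &
                        a' t * x t + b' t * y t = 1]).
have descent u v : pol u -> pol v -> along (fun t => 0 < v t) ->
    P v (fun t => (u t %% v t)%Z) -> P u v.
  move=> hu hv v0 [g [x [y [v' [r' [[pg px py pv' pr'] h]]]]]].
  have pq := pol_div hu hv v0.
  exists g, y, (fun t => x t - (u t %/ v t)%Z * y t), (fun t => (u t %/ v t)%Z * v' t + r' t), v'.
  split; first by split; rewrite //; [apply/polB/polM|apply/polD => //; apply/polM].
  apply: along1 h _ => t [g0 vE rE xy1]; split => //; last by rewrite -xy1; ring.
  by rewrite mulrDl -mulrA -vE -rE -divz_eq.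
have euclid : P a (fun t => (b t %% a t)%Z).
  apply: (euclid_ind (P := P)) => //.
  - move=> u v hu hv u0 v0; exists u, (fun=> 1), (fun=> 0), (fun=> 1), (fun=> 0).
    split; first by split=> //; apply: polC.
    by apply: along2 u0 v0 _ => t h1 h2; split; rewrite ?h2; lia.
  - move=> u v hu hv h; apply: descent => //.
    by apply: along1 h _ => t /andP[].
  - exact: pol_mod.
  - by apply: along1 a0 _ => t at0; rewrite modz_ge0 ?gt_eqF //= ltz_pmod.
have [g [x [y [b' [a' [[pg px py pb' pa'] h]]]]]] := descent b a hb ha a0 euclid.
exists g, y, x, a', b'; split=> //.
by apply: along1 h _ => t [g0 bE aE xy1]; split => //; rewrite addrC.
Qed.

(** * Reduced bases: the terminal step and the starting basis *)

Definition reduced_basis (a b c p q r s : int) : Prop :=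
  [/\ [/\ 0 < p, 0 < s, 0 <= r <= p & 0 <= q <= s], 0 <= b * p - c * q,
      0 <= c * s - b * r & lattice_basis a b c p (- q) r s].

(** With [u = (e, f)] and [v = (- r, s)], [j] is the least number for which [v + j u] has
    nonnegative value. The new basis is [- (v + (j - 1) u)], [v + j u], both of nonnegative value. A
    [J] as in the hypothesis satisfies [j <= J], hence [j e <= r]. *)
Lemma reduced_basis_terminal (a b c e f r s : int) :
  0 < b -> 0 < c -> lattice_basis a b c e f r s ->
  0 <= e < r -> 0 <= f -> 0 < s -> c * s < b * r ->
  e = 0 \/ (exists J, J * e <= r /\ b * r - c * s <= J * (b * e + c * f)) ->
  let l := b * e + c * f in let j := ((b * r - c * s + l - 1) %/ l)%Z in
  0 < l /\
  reduced_basis a b c (r - (j - 1) * e) (s + (j - 1) * f) (r - j * e) (s + j * f).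
Proof.
move=> b0 c0 hB /andP[e0 er] f0 s0 hlt hJ l j.
have det0 : 0 < e * s + f * r by case: hB.
have l0 : 0 < l.
  rewrite /l; case: (ltP 0 e) => he.
    have : 0 < b * e by rewrite mulr_gt0.
    have : 0 <= c * f by rewrite mulr_ge0 // ltW.
    lia.
  have e00 : e = 0 by lia.
  have : 0 < f by rewrite e00 in det0; nia.
  by rewrite e00 mulr0 add0r => ?; rewrite mulr_gt0.
split=> //.
have := divz_eq (b * r - c * s + l - 1) l; rewrite -/j => jE.
have m0 : 0 <= ((b * r - c * s + l - 1) %% l)%Z by rewrite modz_ge0 // gt_eqF.
have ml : ((b * r - c * s + l - 1) %% l)%Z < l by rewrite ltz_pmod.
have j1 : 1 <= j by rewrite /j lez_divRL // mul1r; lia.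
have hj1 : (j - 1) * l < b * r - c * s by rewrite mulrBl mul1r; lia.
have hj2 : b * r - c * s <= j * l by lia.
have hje : j * e <= r.
  case: hJ => [->|[J [h1 h2]]]; first by lia.
  have : j <= J.
    rewrite leNgt; apply/negP => hlt2.
    have : J * l <= (j - 1) * l by apply: ler_wpM2r; lia.
    rewrite -/l in h2; lia.
  by move=> hh; apply: le_trans h1; apply: ler_wpM2r.
have hjf : 0 <= (j - 1) * f by apply: mulr_ge0; lia.
have hje1 : j * e = (j - 1) * e + e by ring.
have hjf1 : j * f = (j - 1) * f + f by ring.
have hb := lattice_basis_addl (-1) (lattice_basis_addr j hB).
split.
- have p0 : 0 < r - (j - 1) * e.
    by case: (eqVneq e 0) => [->|e_neq0]; [rewrite mulr0|]; lia.
  by split; lia.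
- have -> : b * (r - (j - 1) * e) - c * (s + (j - 1) * f) =
     (b * r - c * s) - (j - 1) * l by rewrite /l; ring.
  lia.
- have -> : c * (s + j * f) - b * (r - j * e) = j * l - (b * r - c * s) by rewrite /l; ring.
  lia.
- have -> : r - (j - 1) * e = e - (-1) * (r - j * e) by ring.
  by have -> : - (s + (j - 1) * f) = f + (-1) * (s + j * f) by ring.
Qed.

(** This is a Hermite normal form: second coordinates in the lattice are multiples of [g'], and
    points on the first axis are multiples of [(a', 0)]. The free [k] allows reduction modulo
    [a']. *)
Lemma lattice_basis_bezout (a b c g h x y z w a' b' g' c' k : int) :
  0 < g -> 0 < h -> 0 < a' -> 0 < g' ->
  a = a' * g -> b = b' * g -> a' * x + b' * y = 1 ->
  g = g' * h -> c = c' * h -> g' * z + c' * w = 1 ->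
  lattice_basis a b c a' 0 (y * c' - k * a') g'.
Proof.
move=> g0 h0 a0 g'0 aE bE xy1 gE cE zw1; split.
- by exists b'; rewrite aE bE; ring.
- exists (c' * x + k * b').
  have -> : (c' * x + k * b') * a = c' * g * (a' * x) + k * b' * a' * g by rewrite aE; ring.
  have -> : a' * x = 1 - b' * y by rewrite -xy1; ring.
  have -> : b * - (y * c' - k * a') + c * g' =
    c' * (g' * h) - c' * g * (b' * y) + k * b' * a' * g by rewrite bE cE; ring.
  by rewrite -gE; ring.
- by rewrite mul0r addr0 mulr_gt0.
- move=> X Y [n hn].
  have hY : c' * Y = g' * (n * a' - b' * X).
    apply: (@mulfI _ h); first by rewrite gt_eqF.
    have -> : h * (c' * Y) = c * Y by rewrite cE; ring.
    have -> : c * Y = n * a - b * X by rewrite -hn; ring.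
    by rewrite aE bE gE; ring.
  (* [g'] divides [c' Y] and is coprime to [c']; [j] is the quotient of [Y] by [g']. *)
  pose j := z * Y + w * (n * a' - b' * X).
  have Yj : Y = j * g'.
    have -> : j * g' = z * Y * g' + w * (g' * (n * a' - b' * X)) by rewrite /j; ring.
    by rewrite -hY -[LHS]mulr1 -zw1; ring.
  (* Subtracting [j] times the second vector leaves [(X', 0)]; [a'] divides [b' X'] and is coprime
     to [b']. *)
  have hX : b' * (X + j * (y * c' - k * a')) = (n - j * (c' * x + k * b')) * a'.
    apply: (@mulfI _ g'); first by rewrite gt_eqF.
    have -> : g' * ((n - j * (c' * x + k * b')) * a') =
      g' * (n * a') - (j * g') * c' * (a' * x) - g' * j * k * b' * a' by ring.
    have -> : a' * x = 1 - b' * y by rewrite -xy1; ring.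
    have -> : g' * (n * a') = c' * Y + g' * b' * X by rewrite hY; ring.
    by rewrite Yj; ring.
  set X' := X + j * (y * c' - k * a') in hX.
  exists (X' * x + y * (n - j * (c' * x + k * b'))), j; split; last by rewrite mulr0 add0r.
  have -> : (X' * x + y * (n - j * (c' * x + k * b'))) * a' = X'.
    have -> : (X' * x + y * (n - j * (c' * x + k * b'))) * a' =
      X' * (a' * x) + y * ((n - j * (c' * x + k * b')) * a') by ring.
    by rewrite -hX -[RHS]mulr1 -xy1; ring.
  by rewrite /X' addrK.
Qed.

(** * The reduction carried out on germs *)

Section Reduction.
Variables a b c : nat -> int.
Hypotheses (pol_a : pol a) (pol_b : pol b) (pol_c : pol c).
Hypotheses (a_gt0 : along (fun t => 0 < a t)) (b_gt0 : along (fun t => 0 < b t)).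
Hypothesis c_gt0 : along (fun t => 0 < c t).

Definition has_reduced_basis : Prop := exists p q r s, [/\ pol p, pol q, pol r & pol s] /\
  along (fun t => reduced_basis (a t) (b t) (c t) (p t) (q t) (r t) (s t)).

Lemma has_reduced_basis_terminal e f r s : pol e -> pol f -> pol r -> pol s ->
  along (fun t => [/\ lattice_basis (a t) (b t) (c t) (e t) (f t) (r t) (s t),
    0 <= e t < r t, 0 <= f t, 0 < s t & c t * s t < b t * r t]) ->
  along (fun t => e t = 0 \/ exists J, J * e t <= r t /\
    b t * r t - c t * s t <= J * (b t * e t + c t * f t)) -> has_reduced_basis.
Proof.
move=> pe pf pr ps hB hJ.
pose l t := b t * e t + c t * f t.
pose j t := ((b t * r t - c t * s t + l t - 1) %/ l t)%Z.
have h : along (fun t => 0 < l t /\ reduced_basis (a t) (b t) (c t)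
   (r t - (j t - 1) * e t) (s t + (j t - 1) * f t) (r t - j t * e t) (s t + j t * f t)).
  apply: along3 hB hJ (alongI b_gt0 c_gt0) _ => t [h1 h2 h3 h4 h5] hj [b0 c0].
  exact: reduced_basis_terminal.
have pl : pol l by apply: polD; apply: polM.
have pj : pol j.
  apply: pol_div => //; last by apply: along1 h _ => t [].
  by apply: polB (polC 1); apply: polD => //; apply: polB; apply: polM.
have pj1 : pol (fun t => j t - 1) by apply: polB (polC 1).
exists (fun t => r t - (j t - 1) * e t), (fun t => s t + (j t - 1) * f t),
  (fun t => r t - j t * e t), (fun t => s t + j t * f t).
split; last by apply: along1 h _ => t [].
by split; [apply/polB/polM|apply/polD/polM|apply/polB/polM|apply/polD/polM].
Qed.

(* Both basis vectors are alternately reduced modulo each other in the first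
   coordinate; the loop stops inside a step, when the value b x + c y of the
   second one becomes nonnegative. *)
Lemma has_reduced_basis_descent e r : pol e -> pol r -> along (fun t => 0 <= r t < e t) ->
  forall f s, pol f -> pol s ->
  along (fun t => [/\ lattice_basis (a t) (b t) (c t) (e t) (f t) (r t) (s t),
    0 <= f t, 0 < s t & c t * s t < b t * r t]) -> has_reduced_basis.
Proof.
move=> pe pr hre.
(* The halves differ in which basis vector has the larger first coordinate; each division exchanges
   them. *)
pose P e r := (forall f s, pol f -> pol s ->
    along (fun t => [/\ lattice_basis (a t) (b t) (c t) (e t) (f t) (r t) (s t),
      0 <= f t, 0 < s t & c t * s t < b t * r t]) -> has_reduced_basis) /\
  (forall f s, pol f -> pol s ->
    along (fun t => [/\ lattice_basis (a t) (b t) (c t) (r t) (f t) (e t) (s t),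
      0 <= f t, 0 < s t & c t * s t < b t * e t]) -> has_reduced_basis).
suff [] : P e r by [].
apply: (euclid_ind (P := P)) => // {e r pe pr hre} u v pu pv.
(* With [v = 0] the first half is vacuous, as it would give [c s < 0]; the second is terminal with
   [e = 0]. *)
- move=> u0 v0; split=> f s pf ps h.
    have [] := along_False (alongI (alongI v0 c_gt0) h) => t.
    by case=> [[v0t c0t] [_ _ s0 hlt]]; rewrite v0t mulr0 in hlt; nia.
  apply: (has_reduced_basis_terminal pv pf pu ps).
    by apply: along3 h u0 v0 _ => t [h1 h2 h3 h4] u0t v0t; split=> //; rewrite v0t; lia.
  by apply: along1 v0 _ => t; left.
- move=> huv [IHX IHY].
  have v0 : along (fun t => 0 < v t) by apply: along1 huv _ => t /andP[].
  have pK := pol_div pu pv v0.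
  split=> f s pf ps h.
    apply: (IHY (fun t => f t + (u t %/ v t)%Z * s t) s) => //.
      by apply: polD => //; apply: polM.
    apply: along2 h huv _ => t [h1 h2 h3 h4] huvt; split=> //.
      by rewrite /modz; apply: lattice_basis_addl.
    have : 0 <= (u t %/ v t)%Z by rewrite divz_ge0; lia.
    by move=> hK; rewrite addr_ge0 // mulr_ge0 // ltW.
  pose J t := (u t %/ v t)%Z.
  have ps' : pol (fun t => s t + J t * f t) by apply: polD => //; apply: polM.
  have pr' : pol (fun t => (u t %% v t)%Z) by apply: pol_mod.
  (* If adding all [J] copies makes the value nonnegative, the sign changes within this division and
     [J] is the bound the terminal step asks for. *)
  have [hl|hl] := pol_le_lt (polM pol_b pr') (polM pol_c ps').
    apply: (has_reduced_basis_terminal pv pf pu ps).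
      by apply: along2 h huv _ => t [h1 h2 h3 h4] huvt; split=> //; lia.
    apply: along2 hl huv _ => t; rewrite /modz -/(J t) => hlt huvt; right.
    exists (J t); split; last by lia.
    by have : 0 <= (u t %% v t)%Z by [rewrite modz_ge0; lia]; rewrite /modz -/(J t); lia.
  apply: (IHX f (fun t => s t + J t * f t)) => //.
  apply: along3 h huv hl _ => t [h1 h2 h3 h4] huvt hlt; split=> //.
    by rewrite /modz -/(J t); apply: lattice_basis_addr.
  have : 0 <= J t by rewrite /J divz_ge0; lia.
  by move=> hK; rewrite ltr_wpDr // mulr_ge0.
Qed.

Lemma reduced_basis_exists : has_reduced_basis.
Proof.
have [g [x [y [a' [b' [[pg px py pa' pb'] hab]]]]]] := pol_bezout pol_a pol_b a_gt0.
have g0 : along (fun t => 0 < g t) by apply: along1 hab _ => t [].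
have [h [z [w [g' [c' [[ph pz pw pg' pc'] hgc]]]]]] := pol_bezout pg pol_c g0.
have a'0 : along (fun t => 0 < a' t).
  by apply: along2 hab a_gt0 _ => t [gt0 -> _ _]; rewrite pmulr_lgt0.
have g'0 : along (fun t => 0 < g' t).
  by apply: along2 hgc g0 _ => t [ht0 -> _ _]; rewrite pmulr_lgt0.
have pyc : pol (fun t => y t * c' t) by apply: polM.
pose r t := (y t * c' t %% a' t)%Z.
have pr : pol r by apply: pol_mod.
have hr : along (fun t => 0 <= r t < a' t).
  by apply: along1 a'0 _ => t a0; rewrite modz_ge0 ?gt_eqF //= ltz_pmod.
have hB : along (fun t => lattice_basis (a t) (b t) (c t) (a' t) 0 (r t) (g' t)).
  apply: along3 (alongI hab hgc) a'0 g'0 _ => t [[h1 h2 h3 h4] [h5 h6 h7 h8]] h9 h10.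
  exact: (lattice_basis_bezout _ h1 h5 h9 h10 h2 h3 h4 h6 h7 h8).
(* If the second vector has nonnegative value, the starting basis is reduced with [q = 0]. *)
have [hl|hl] := pol_le_lt (polM pol_b pr) (polM pol_c pg').
  exists a', (fun=> 0), r, g'; split; first by split=> //; apply: polC.
  apply: along3 (alongI hB hl) (alongI hr b_gt0) (alongI a'0 g'0) _.
  move=> t [h1 h2] [h3 h4] [h5 h6]; split; last by rewrite oppr0.
  - by split=> //; lia.
  - by rewrite mulr0 subr0 mulr_ge0 // ltW.
  - by lia.
apply: (has_reduced_basis_descent pa' pr hr (polC 0) pg').
by apply: along3 hB hl g'0 _ => t.
Qed.

Lemma pol_frob3 : exists F, pol F /\ along (fun t => frob3 (a t) (b t) (c t) (F t)).
Proof.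
have [p [q [r [s [[pp pq pr ps] h]]]]] := reduced_basis_exists.
pose F1 t := b t * (p t - 1) + c t * (s t - q t - 1).
pose F2 t := b t * (p t - r t - 1) + c t * (s t - 1).
have p1 : pol F1.
  by apply: polD; apply: polM => //; apply: polB (polC 1) => //; apply: polB.
have p2 : pol F2.
  by apply: polD; apply: polM => //; apply: polB (polC 1) => //; apply: polB.
have key F : along (fun t => F t = Num.max (F1 t) (F2 t) - a t) ->
    along (fun t => frob3 (a t) (b t) (c t) (F t)).
  move=> hF; apply: along3 h hF (alongI a_gt0 (alongI b_gt0 c_gt0)) _.
  move=> t [[h1 h2 h3 h4] h5 h6 h7] h8 [h9 [h10 h11]].
  exact: frob3_basis h7 h8.
(* Along [tau] one corner wins for good, so the maximum is a single polynomial. *)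
have [hle|hlt] := pol_le_lt p1 p2.
- exists (fun t => F2 t - a t); split; first exact: polB.
  by apply: key; apply: along1 hle _ => t ht; rewrite (elimT max_idPr).
- exists (fun t => F1 t - a t); split; first exact: polB.
  by apply: key; apply: along1 hlt _ => t ht; rewrite (elimT max_idPl) // ltW.
Qed.

End Reduction.

End Along.

(** * Compactness and gluing *)

(** The residue of [tau] modulo the period selects one constituent; the threshold is at least 1
    because the value at 0 is junk. *)
Lemma EQP_pol (tau : nat -> nat) (f : nat -> int) : coherent tau -> EQP f -> pol tau f.
Proof.
move=> coh [g [[m [m0 [p hp]]] [T hT]]].
exists (p (tau m %% m)%N), m, (maxn 1 T); split => // t; rewrite geq_max => /andP[t0 ht] htau.
by rewrite hT // hp // htau.
Qed.

(* A sequence of residues modulo n`! refining one another along which no modulus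
   is good is a point of the compact space of coherent families. *)
Lemma coherent_compact (Q : nat -> nat -> Prop) :
  (forall m k r r', (0 < m)%N -> (0 < k)%N -> r' = r %[mod m] -> Q m r -> Q (m * k)%N r') ->
  (forall tau, coherent tau -> exists m, (0 < m)%N /\ Q m (tau m)) ->
  exists M, (0 < M)%N /\ forall r, Q M r.
Proof.
move=> Qmono Qtau; apply: contrapT => noM.
(* A class is bad if no refinement of the modulus makes all its subclasses good. *)
pose B m r := ~ exists k, (0 < k)%N /\ forall r', r' = r %[mod m] -> Q (m * k)%N r'.
(* If no subclass modulo [m * j] were bad, the product of their finitely many witnesses would serve
   for the whole class. *)
have B_extend m r j : (0 < m)%N -> (0 < j)%N -> B m r ->
    exists r', r' = r %[mod m] /\ B (m * j)%N r'.
  move=> m0 j0 hB; apply: contrapT => hno; apply: hB.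
  have mj0 : (0 < m * j)%N by rewrite muln_gt0 m0.
  have cover r' : r' = r %[mod m] ->
      exists k, (0 < k)%N /\ forall r'', r'' = r' %[mod m * j] -> Q (m * j * k)%N r''.
    by move=> hr'; apply: contrapT => hk; apply: hno; exists r'.
  have finite N : exists K, (0 < K)%N /\ forall r', (r' < N)%N -> r' = r %[mod m] ->
      forall r'', r'' = r' %[mod m * j] -> Q (m * j * K)%N r''.
    elim: N => [|N [K [K0 hK]]]; first by exists 1%N.
    have [k [k0 hk]] : exists k, (0 < k)%N /\ (N = r %[mod m] ->
        forall r'', r'' = N %[mod m * j] -> Q (m * j * k)%N r'').
      have [/eqP h|/eqP h] := boolP (N == r %[mod m]); last by exists 1%N.
      by have [k [k0 hk]] := cover N h; exists k.
    exists (K * k)%N; split; first by rewrite muln_gt0 K0.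
    move=> r'; rewrite ltnS leq_eqVlt => /orP[/eqP->|hr'] hr r'' hr''.
      rewrite [(K * k)%N]mulnC mulnA; apply: (Qmono _ _ r'') => //.
        by rewrite muln_gt0 mj0.
      exact: hk.
    rewrite mulnA; apply: (Qmono _ _ r'') => //; first by rewrite muln_gt0 mj0.
    exact: hK hr' hr _ hr''.
  have [K [K0 hK]] := finite (m * j)%N.
  exists (j * K)%N; split; first by rewrite muln_gt0 j0.
  move=> r' hr'; rewrite mulnA; apply: (hK (r' %% (m * j))%N); first exact: ltn_pmod.
    by rewrite modn_dvdm ?dvdn_mulr.
  by rewrite modn_mod.
have /choice[f hf] : forall x : nat * nat, exists y, B (x.1)`! x.2 ->
    y = x.2 %[mod (x.1)`!] /\ B (x.1.+1)`! y.
  move=> [n r] /=.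
  have [hB|hB] := pselect (B n`! r); last by exists 0%N.
  have [r' [h1 h2]] := B_extend _ _ n.+1 (fact_gt0 n) isT hB.
  by exists r' => _; split=> //; rewrite factS mulnC.
(* The path of bad classes modulo [n]![. It is itself a coherent family, since]m[divides]m[!]. *)
pose x n := iteri n (fun i r => f (i, r)) 0%N.
have xB n : B n`! (x n).
  elim: n => [|n /(hf (n, x n))[]//].
  move=> [k [k0 hk]]; apply: noM; exists k; split=> // r.
  by rewrite -[k]mul1n; apply: hk; rewrite !modn1.
have xmod n k : x (n + k)%N = x n %[mod n`!].
  elim: k => [|k IH]; first by rewrite addn0.
  have [/= h _] := hf (_, _) (xB (n + k)%N).
  rewrite addnS -IH; apply/eqP.
  have dv : (n`! %| (n + k)`!)%N.
    by elim: k {IH h} => [|k IHk]; rewrite ?addn0 // addnS factS dvdn_mull.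
  by rewrite -(modn_dvdm (x (n + k).+1) dv) /= -/(x (n + k)%N) h modn_dvdm.
have xcoh : coherent x.
  move=> m k m0 k0.
  have -> : (m * k = m + m * k.-1)%N by rewrite -[in LHS](prednK k0) mulnS.
  have dv : (m %| m`!)%N by apply: dvdn_fact; rewrite m0 leqnn.
  by rewrite -(modn_dvdm (x (m + _)%N) dv) xmod modn_dvdm.
have [m [m0 hQ]] := Qtau x xcoh.
apply: (xB m); exists 1%N; split=> // r hr; rewrite muln1.
have mE : (m`! = m * (m.-1)`!)%N by rewrite -[in LHS](prednK m0) factS prednK.
rewrite mE; apply: (Qmono m _ (x m)) => //; first exact: fact_gt0.
have dv : (m %| m`!)%N by rewrite mE dvdn_mulr.
by rewrite -(modn_dvdm r dv) hr modn_dvdm.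
Qed.

(** Shifting [t] by a multiple of [M d], with [d] a denominator of [p], changes [p] by an integer.
    This makes the glued function integral at small [t] too. *)
Lemma rat_poly_int_periodic (p : {poly rat}) (M T : nat) : (0 < M)%N ->
  forall r, (forall t, (T <= t)%N -> t = r %[mod M] -> exists x : int, x%:~R = p.[t%:R]) ->
  forall t, t = r %[mod M] -> exists x : int, x%:~R = p.[t%:R].
Proof.
move=> M0 r hp t ht; have [q [d [d0 pE]]] := rat_poly_scale_nat p.
pose t' := (t + T * (M * d))%N.
have [||x hx] := hp t'.
- by rewrite /t' (leq_trans _ (leq_addl _ _)) // leq_pmulr // muln_gt0 M0.
- by rewrite /t' mulnCA addnC mulnC modnMDl.
have dQ0 : (d%:R : rat) != 0 by rewrite pnatr_eq0 -lt0n.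
have pq (n : nat) : p.[n%:R] = d%:R^-1 * (q.[n%:Z])%:~R.
  by rewrite pE hornerZ -[n%:R]/(n%:~R) horner_map.
have /dvdzP[y hy] : (d %| q.[t'%:Z] - q.[t%:Z])%Z.
  apply: dvdz_trans (dvdz_horner_sub _ _ _).
  by apply/dvdzP; exists ((T * M)%N%:Z); rewrite /t'; lia.
exists (x - y); rewrite rmorphB /= hx !pq; apply: (mulfI dQ0).
rewrite mulrBr !mulrA !mulfV // !mul1r.
have -> : q.[t'%:Z] = y * d + q.[t%:Z] by rewrite -hy subrK.
by rewrite rmorphD rmorphM /=; ring.
Qed.

(** * Families of at most three generators and the final assembly *)

(** Taking [phi] to be the identity of [int] or [Posz] treats group and semigroup at once.
    Coefficients at coinciding indices are added up. *)
Lemma combination_cover3 (R : nmodType) (phi : R -> int) (n : nat) (a : 'I_n -> int)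
    (i1 i2 i3 : 'I_n) (x : int) :
  phi 0 = 0 -> {morph phi : u v / u + v} -> (forall i, [\/ i = i1, i = i2 | i = i3]) ->
  (exists z : 'I_n -> R, x = \sum_(i < n) phi (z i) * a i) <->
  exists u v w : R, x = phi u * a i1 + phi v * a i2 + phi w * a i3.
Proof.
move=> phi0 phiD cover; split=> [[z ->]|[u [v [w ->]]]].
- apply: (big_ind (fun y => exists u v w : R, y = phi u * a i1 + phi v * a i2 + phi w * a i3)).
  + by exists 0, 0, 0; rewrite phi0 !mul0r !addr0.
  + move=> _ _ [u [v [w ->]]] [u' [v' [w' ->]]].
    by exists (u + u'), (v + v'), (w + w'); rewrite !phiD; ring.
  + move=> i _; case: (cover i) => ->.
    * by exists (z i1), 0, 0; rewrite phi0 !mul0r !addr0.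
    * by exists 0, (z i2), 0; rewrite phi0 !mul0r addr0 add0r.
    * by exists 0, 0, (z i3); rewrite phi0 !mul0r !add0r.
- have single k i : phi k * a i = \sum_(j < n) phi (if j == i then k else 0) * a j.
    rewrite (bigD1 i) //= eqxx big1 ?addr0 // => j /negPf->.
    by rewrite phi0 mul0r.
  exists (fun j => (if j == i1 then u else 0) + (if j == i2 then v else 0) +
    (if j == i3 then w else 0)).
  rewrite !single -!big_split; apply: eq_bigr => j _ /=.
  by rewrite !phiD !mulrDl.
Qed.

Lemma frob3_frobenius (n : nat) (a : 'I_n -> int) (i1 i2 i3 : 'I_n) (x : int) :
  (forall i, [\/ i = i1, i = i2 | i = i3]) -> frob3 (a i1) (a i2) (a i3) x ->
  is_frobenius_number a x.
Proof.
move=> cover [h1 h2 h3].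
have grp y : in_group a y <-> _ :=
  @combination_cover3 int id n a i1 i2 i3 y erefl (fun _ _ => erefl) cover.
have sgrp y : in_semigroup a y <-> _ :=
  @combination_cover3 nat Posz n a i1 i2 i3 y erefl PoszD cover.
split; first by apply/grp.
  by move/sgrp.
move=> y /grp hy hny; apply: h3 => // /sgrp; exact: hny.
Qed.

Theorem theorem2 (n : nat) (hn : (0 < n <= 3)%N) (a : 'I_n -> nat -> int)
    (ha : forall i : 'I_n, EQP (a i))
    (hpos : forall i : 'I_n, eventually (fun t => 0 < a i t)) :
  exists F : nat -> int,
    EQP F /\ eventually (fun t => is_frobenius_number (fun i => a i t) (F t)).
Proof.
have [i1 [i2 [i3 cover]]] : exists i1 i2 i3 : 'I_n, forall i, [\/ i = i1, i = i2 | i = i3].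
  case: n hn {a ha hpos} => // n; rewrite ltnS => hn.
  (* An [inord] out of range falls back to index 0, which gives the repetitions when [n < 3]. *)
  exists (inord 0), (inord 1), (inord 2) => i; rewrite -[i]inord_val.
  have : (i < 3)%N by apply: leq_trans (ltn_ord i) _.
  by case: (i : nat) => [|[|[|//]]] _; [constructor 1|constructor 2|constructor 3].
pose Q m r := exists (p : {poly rat}) (T : nat), forall t, (T <= t)%N -> t = r %[mod m] ->
  exists x : int, x%:~R = p.[t%:R] /\ is_frobenius_number (fun i => a i t) x.
have [||M [M0 hM]] := @coherent_compact Q.
- move=> m k r r' m0 k0 hr [p [T h]]; exists p, T => t hT ht; apply: h => //.
  by rewrite -hr -(modn_dvdm t (dvdn_mulr k (dvdnn m))) ht modn_dvdm // dvdn_mulr.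
- move=> tau coh.
  have pola i : pol tau (a i) by apply: EQP_pol.
  have apos i : along tau (fun t => 0 < a i t).
    by have [T hT] := hpos i; apply: along1 (along_ge tau T) _ => t; apply: hT.
  have [F [[p hp] hF]] := pol_frob3 coh (pola i1) (pola i2) (pola i3) (apos i1) (apos i2) (apos i3).
  have [m [T [m0 h]]] := alongI coh hp hF.
  exists m; split=> //; exists p, T => t hT ht; have [h1 h2] := h t hT ht.
  by exists (F t); split=> //; apply: frob3_frobenius cover h2.
have [p hp] := choice hM; have [T {}hp] := choice hp.
have /choice[g hg] : forall t, exists x : int, x%:~R = (p (t %% M)%N).[t%:R].
  move=> t; apply: (@rat_poly_int_periodic _ M (T (t %% M)%N) M0 (t %% M)%N).
    by move=> t' hT ht'; have [x [hx _]] := hp _ t' hT ht'; exists x.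
  by rewrite modn_mod.
exists g; split.
  exists g; split; last by exists 0%N.
  by exists M; split=> //; exists p.
(* Finitely many residues have a common threshold. *)
exists (\max_(r < M) T r) => t ht.
have [||x [hx hF]] := hp (t %% M)%N t; last 1 first.
- suff -> : g t = x by [].
  by apply: (@intr_inj rat); rewrite hg hx.
- apply: leq_trans ht.
  exact: (@leq_bigmax _ (fun r : 'I_M => T r) (Ordinal (ltn_pmod t M0))).
- by rewrite modn_mod.
Qed.
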